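(* Let $\alpha\in(0,1)$ be irrational. Extend the map $\Psi_\alpha : E_{(\alpha)}\to\mathbb{N}$, $d\mapsto\sum_{j\geqslant1}d_jq_{j-1}$, to a map $\widetilde\Psi_\alpha$ on $F_\alpha=E_{(\alpha)}\cup E^c_{(\alpha)}$ by setting $\widetilde\Psi_\alpha=\Psi_\alpha$ on $E_{(\alpha)}$ and $$\widetilde\Psi_\alpha(e)=-1-\sum_{k=1}^\infty(a_k-e_k)q_{k-1}\qquad\text{for all } e\in E^c_{(\alpha)}.$$ Then $\widetilde\Psi_\alpha$ is an order isomorphism from $(F_\alpha,\leqslant_R)$ to $(\mathbb{Z},\leqslant)$, and $$\forall n\in\mathbb{Z},\qquad \Lambda_\alpha(\widetilde\Psi_\alpha^{-1}(n))=\{n\alpha\}.$$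
   Context: $\{x\}$ denotes the fractional part of $x$. For irrational $\alpha\in(0,1)$ let $[0,a_1,a_2,\dots]$ be its continued fraction expansion (each $a_k$ a positive integer), and $p_k/q_k=[0,a_1,\dots,a_k]$ its reduced convergents, with $p_{-1}=1,\ q_{-1}=0,\ p_0=0,\ q_0=1$. $E_\alpha$ is the set of $\alpha$-admissible sequences: sequences $d=(d_j)_{j\geqslant1}$ of nonnegative integers such that (a) $0\leqslant d_j\leqslant a_j$ for all $j\geqslant1$; (b) if $d_j=0$ then either $d_i=0$ for all $i\geqslant j$, or $j\geqslant2$ and $d_{j-1}=a_{j-1}$; (c) there is no $k\geqslant1$ such that $d_{k+2i}=a_{k+2i}$ and $d_{k+2i+1}=0$ for all $i\geqslant0$. $E_{(\alpha)}$ is the set of $d\in E_\alpha$ that are eventually $0$; $E^c_{(\alpha)}$ is the set of $e\in E_\alpha$ for which there is $k$ with $e_i=a_i$ for all $i>k$. $\Lambda_\alpha : E_\alpha\to[0,1)$ is the map $\Lambda_\alpha(d)=\sum_{j\geqslant1}d_j(q_{j-1}\alpha-p_{j-1})$. The order on $F_\alpha$ is: $d<_R d'$ iff there is $k\geqslant1$ such that either ($d_k<d'_k$ and $d_i=d'_i$ for all $i>k$), or ($d_i=a_i$ and $d'_i=0$ for all $i\geqslant k$). *)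

(* Defs.v *)
From HB Require Import structures.
From mathcomp Require Import all_boot all_order all_algebra.
From mathcomp Require Import all_classical all_reals all_analysis.
Import Order.TTheory GRing.Theory Num.Theory.
Import numFieldNormedType.Exports.

Set Implicit Arguments.
Unset Strict Implicit.
Unset Printing Implicit Defensive.

Local Open Scope classical_set_scope.
Local Open Scope ring_scope.

(* Sequences indexed by j >= 1 on paper are functions on nat shifted by one:  *)
(* [d j] is the paper's d_{j+1} and [cf_digit alpha j] is a_{j+1}.            *)
(* Convergents are not shifted: [cf_p alpha k], [cf_q alpha k] are p_k, q_k   *)
(* (k >= 0), so that d_{j+1} is multiplied by q_j.                            *)

Section Ostrowski.
Context {R : realType}.
Implicit Types (alpha x : R) (d e : nat -> nat) (k : nat).

Definition frac_part x : R := x - (Num.floor x)%:~R.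

(* The continued fraction algorithm: x_0 = alpha, x_{k+1} = {1 / x_k} and     *)
(* a_{k+1} = floor (1 / x_k).                                                 *)
Definition cf_digit alpha k : nat :=
  Num.truncn (iter k (fun x => frac_part x^-1) alpha)^-1.

(* [0, a_1, ..., a_k] = 1 / (a_1 + 1 / (a_2 + ... + 1 / a_k))                 *)
Definition convergent alpha k : rat :=
  foldr (fun (a : nat) (x : rat) => (a%:R + x)^-1) 0 (mkseq (cf_digit alpha) k).

Definition cf_p alpha k : int := numq (convergent alpha k).
Definition cf_q alpha k : int := denq (convergent alpha k).

Definition admissible alpha : set (nat -> nat) := [set d |
  [/\ forall j, (d j <= cf_digit alpha j)%N,
      forall j, d j = 0%N ->
        (forall i, (j <= i)%N -> d i = 0%N) \/
        ((0 < j)%N /\ d j.-1 = cf_digit alpha j.-1) &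
      ~ exists k, forall i,
          d (k + i.*2)%N = cf_digit alpha (k + i.*2)%N /\
          d (k + i.*2).+1 = 0%N]].

Definition admissible_ev0 alpha : set (nat -> nat) :=
  admissible alpha `&` [set d | exists k, forall i, (k <= i)%N -> d i = 0%N].

Definition admissible_evmax alpha : set (nat -> nat) :=
  admissible alpha `&`
  [set e | exists k, forall i, (k <= i)%N -> e i = cf_digit alpha i].

Definition Fset alpha : set (nat -> nat) :=
  admissible_ev0 alpha `|` admissible_evmax alpha.

Definition ltR alpha d d' : Prop :=
  exists k,
    ((d k < d' k)%N /\ forall i, (k < i)%N -> d i = d' i) \/
    (forall i, (k <= i)%N -> d i = cf_digit alpha i /\ d' i = 0%N).

Definition leR alpha d d' : Prop := d = d' \/ ltR alpha d d'.

Definition Lambda alpha d : R :=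
  limn (series (fun j =>
    (d j)%:R * ((cf_q alpha j)%:~R * alpha - (cf_p alpha j)%:~R))).

(* Sums over [set: nat] are finitely supported sums: only finitely many terms *)
(* are nonzero for the sequences to which they are applied.                   *)
Definition Psi alpha d : int :=
  \sum_(j \in [set: nat]) (d j)%:Z * cf_q alpha j.

(* The second branch is meant for e in [admissible_evmax alpha]; the map is   *)
(* only used on [Fset alpha].                                                 *)
Definition Psi_ext alpha d : int :=
  if d \in admissible_ev0 alpha then Psi alpha d
  else - 1 - \sum_(k \in [set: nat])
               ((cf_digit alpha k)%:Z - (d k)%:Z) * cf_q alpha k.

(* The library's partial inverse of a function restricted to a set; the       *)
(* default value (the zero sequence) is only returned outside the image.      *)
Definition Psi_ext_inv alpha : int -> nat -> nat :=
  'pinv_(fun=> fun=> 0%N) (Fset alpha) (Psi_ext alpha).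

End Ostrowski.

(* Main.v *)
Require Import Defs.
From HB Require Import structures.
From mathcomp Require Import all_boot all_order all_algebra.
From mathcomp Require Import all_classical all_reals all_analysis.
From mathcomp Require Import zify ring lra.
Import Order.TTheory GRing.Theory Num.Theory.
Import numFieldNormedType.Exports.

Local Open Scope classical_set_scope.
Local Open Scope ring_scope.

(** An admissible sequence is a lazy Ostrowski expansion: below its last nonzero
    digit, a zero can only follow a maximal digit. Write q_m for the convergent
    denominators, with q_{-1} = 0. Two facts about prefixes of length m carry
    the combinatorial half of the proof.
    - Digits bounded by the a_j have value at most q_m + q_{m-1} - 1, with
      equality for the maximal digits ([psi_sum_max]).
    - A prefix whose zeros all follow a maximal digit has value at least q_{m-1}
      ([lazy_prefix_lb]), and every integer between these two bounds is the
      value of such a prefix ([lazy_prefix_exists]).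

    The two bounds differ by just enough for the topmost digit at which two
    sequences disagree to decide the order of their values ([psi_sum_lt]). Hence
    the extended Psi is strictly increasing for the relation [ltR]. As any two
    distinct elements of F_alpha are comparable ([ltR_total]), injectivity and
    the equivalence of the two orders follow. Surjectivity comes from completing
    a prefix by zeros, for n >= 0, or by maximal digits, for n < 0. In the second
    case -1 - sum (a_j - e_j) q_{j-1} is the value of the prefix minus
    q_m + q_{m-1}, as the sum of all the a_j q_{j-1} telescopes.

    For Lambda, put theta_k = q_k alpha - p_k. Its sign alternates and it tends
    to 0. As the theta_k satisfy the same recurrence as the q_k, the same
    telescoping gives, for a sequence that is maximal from index N on,
    Lambda = (partial sum) - theta_N - theta_{N-1}, which differs from
    Psi * alpha by an integer ([Lambda_int]). It remains to see that Lambda lies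
    in [0, 1). Keeping only the digits whose theta is positive, and making them
    maximal, bounds every partial sum by 1 + theta_k for some theta_k < 0
    ([err_sum_ub]). Keeping the first digit (nonzero unless the sequence
    vanishes) and making maximal those digits whose theta is negative, bounds it
    below by some theta_k > 0 ([err_sum_lb]). Passing to the limit may lose the
    strict inequality Lambda < 1, but Lambda = 1 would make alpha rational. *)

(** * Convergents of a digit sequence *)

Fixpoint cf_rec (a : nat -> nat) (u v n : nat) : nat :=
  match n with
  | 0 => u
  | n'.+1 => match n' with
             | 0 => v
             | m.+1 => (a m * cf_rec a u v n' + cf_rec a u v m)%N
             end
  end.

(** The index is shifted by one so that the conventional initial values have an
    index in [nat]: [cf_den a k.+1] is q_k and [cf_den a 0] is q_{-1} = 0. *)
Definition cf_den a : nat -> nat := cf_rec a 0 1.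

(** The same shift: [cf_num a k.+1] is p_k and [cf_num a 0] is p_{-1} = 1. *)
Definition cf_num a : nat -> nat := cf_rec a 1 0.

Lemma cf_denSS a n : cf_den a n.+2 = (a n * cf_den a n.+1 + cf_den a n)%N.
Proof. by []. Qed.

Lemma cf_numSS a n : cf_num a n.+2 = (a n * cf_num a n.+1 + cf_num a n)%N.
Proof. by []. Qed.

Lemma cf_det a n :
  (cf_num a n)%:Z * (cf_den a n.+1)%:Z - (cf_num a n.+1)%:Z * (cf_den a n)%:Z
  = (-1) ^+ n.
Proof.
elim: n => [|n IH]; first by [].
rewrite cf_denSS cf_numSS exprS -IH !PoszD !PoszM; ring.
Qed.

(** The determinant identity is a Bezout relation. *)
Lemma coprime_cf a n : coprime (cf_num a n.+1) (cf_den a n.+1).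
Proof.
apply/(@coprimezP (cf_num a n.+1) (cf_den a n.+1)).
exists (- (-1) ^+ n * (cf_den a n)%:Z, (-1) ^+ n * (cf_num a n)%:Z) => /=.
transitivity ((-1) ^+ n * (-1) ^+ n : int); last by rewrite -expr2 sqrr_sign.
rewrite -{3}(cf_det a n); ring.
Qed.

Section PositiveDigits.
Variable a : nat -> nat.
Hypothesis a_gt0 : forall j, (0 < a j)%N.

(** The recurrence gives q_{k+2} >= q_{k+1} + q_k, so both bounds are proved
    together: positivity of q_k provides the increment. *)
Lemma cf_den_growth m : (m <= cf_den a m.+1)%N /\ (0 < cf_den a m.+1)%N.
Proof.
elim/ltn_ind: m => -[|[|m]] IH //.
  by rewrite cf_denSS /cf_den /= muln1 addn0 a_gt0.
have [//|h1 h2] := IH m.+1; have [|h3 h4] := IH m; first by lia.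
have := leq_mul (a_gt0 m.+1) (leqnn (cf_den a m.+2)).
rewrite (cf_denSS _ m.+1); lia.
Qed.

Lemma cf_den_comb_gt0 (K : numFieldType) n (x : K) : 0 <= x ->
  0 < (cf_den a n.+1)%:R + (cf_den a n)%:R * x.
Proof.
move=> x0; have [_ q0] := cf_den_growth n.
by rewrite ltr_wpDr ?ltr0n // mulr_ge0.
Qed.

(** With x = 0 this computes the convergents; with x the n-th remainder of the
    continued fraction algorithm, the left-hand side is alpha itself. *)
Lemma foldr_cf (K : numFieldType) n (x : K) : 0 <= x ->
  foldr (fun (b : nat) (y : K) => (b%:R + y)^-1) x (mkseq a n) =
  ((cf_num a n.+1)%:R + (cf_num a n)%:R * x) /
  ((cf_den a n.+1)%:R + (cf_den a n)%:R * x).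
Proof.
elim: n x => [|n IH] x x0.
  by rewrite /= mul1r mul0r addr0 add0r divr1.
have an : 0 < (a n)%:R + x by rewrite ltr_wpDr // ltr0n.
have an' : 0 <= ((a n)%:R + x)^-1 by rewrite invr_ge0 ltW.
have d1 := cf_den_comb_gt0 _ n _ an'; have d2 := cf_den_comb_gt0 _ n.+1 _ x0.
rewrite mkseqS foldr_rcons IH // cf_numSS cf_denSS !natrD !natrM.
rewrite cf_denSS natrD natrM in d2.
by field; rewrite !gt_eqF //=.
Qed.

End PositiveDigits.

(** * Values of digit prefixes *)

Definition psi_sum a (d : nat -> nat) m : nat :=
  (\sum_(j < m) d j * cf_den a j.+1)%N.

Lemma psi_sumS a d m :
  psi_sum a d m.+1 = (psi_sum a d m + d m * cf_den a m.+1)%N.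
Proof. by rewrite /psi_sum big_ord_recr. Qed.

Lemma psi_sum0 a d : psi_sum a d 0 = 0%N.
Proof. by rewrite /psi_sum big_ord0. Qed.

Lemma psi_sumZ a d m :
  (psi_sum a d m)%:Z = \sum_(j < m) (d j)%:Z * (cf_den a j.+1)%:Z.
Proof.
by elim: m => [|m IH];
  rewrite ?psi_sum0 ?psi_sumS ?big_ord0 ?big_ord_recr -?IH.
Qed.

Lemma psi_sum_max a m : (psi_sum a a m).+1 = (cf_den a m.+1 + cf_den a m)%N.
Proof.
elim: m => [|m IH]; first by rewrite psi_sum0.
rewrite psi_sumS cf_denSS; lia.
Qed.

Lemma leq_psi_sum a d m :
  (forall j, d j <= a j)%N -> (psi_sum a d m <= psi_sum a a m)%N.
Proof. by move=> h; apply: leq_sum => j _; rewrite leq_mul2r h orbT. Qed.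

Definition lazy_prefix (a d : nat -> nat) m : Prop :=
  forall j, (j < m)%N -> d j = 0%N -> (0 < j)%N /\ d j.-1 = a j.-1.

Lemma lazy_prefixS a d m : lazy_prefix a d m ->
  (d m = 0%N -> (0 < m)%N /\ d m.-1 = a m.-1) -> lazy_prefix a d m.+1.
Proof.
by move=> h hm j; rewrite ltnS leq_eqVlt => /orP[/eqP->//|]; exact: h.
Qed.

(** If the top digit is nonzero, it alone contributes the bound. If it is zero,
    the digit below it is maximal, and the recurrence turns the bound for the
    prefix shorter by two into the bound wanted. *)
Lemma lazy_prefix_lb a d m : lazy_prefix a d m -> (cf_den a m <= psi_sum a d m)%N.
Proof.
elim/ltn_ind: m => -[|[|m]] IH h //.
- rewrite psi_sumS; case: (posnP (d 0)) => [/(h 0 isT)[]//|].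
  by rewrite (_ : cf_den a 1 = 1)%N // muln1 psi_sum0 add0n.
- case: (posnP (d m.+1)) => [h0|h0]; last first.
    rewrite psi_sumS; apply: leq_trans (leq_addl _ _).
    exact: leq_pmull.
  have [_ /= e] := h m.+1 (ltnSn _) h0.
  have : (cf_den a m <= psi_sum a d m)%N.
    by apply: IH => // j jm; apply: h; apply: ltn_trans jm _.
  rewrite !psi_sumS h0 e cf_denSS; lia.
Qed.

(** Increasing the digit k by one adds q_k to the value, while the digits below
    k can lose at most (q_k + q_{k-1} - 1) - q_{k-1} = q_k - 1. *)
Lemma psi_sum_lt a d d' k : (forall j, d j <= a j)%N -> (d k < d' k)%N ->
  lazy_prefix a d' k -> (psi_sum a d k.+1 < psi_sum a d' k.+1)%N.
Proof.
move=> da dd' /lazy_prefix_lb lb.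
have := leq_psi_sum a d k da; have := psi_sum_max a k; rewrite !psi_sumS => Sa.
have : (d k * cf_den a k.+1 + cf_den a k.+1 <= d' k * cf_den a k.+1)%N.
  by rewrite addnC -mulSn leq_mul2r dd' orbT.
lia.
Qed.

Lemma psi_sum_lt_extend a d d' k M : (k <= M)%N ->
  (forall i, (k <= i)%N -> d i = d' i) ->
  (psi_sum a d k < psi_sum a d' k)%N -> (psi_sum a d M < psi_sum a d' M)%N.
Proof.
move=> /subnKC <- e lt; elim: (M - k)%N => [|t IH]; first by rewrite addn0.
by rewrite addnS !psi_sumS e ?leq_addr // ltn_add2r.
Qed.

Definition splice m (d c : nat -> nat) j := if (j < m)%N then d j else c j.

Lemma splice_lt m d c j : (j < m)%N -> splice m d c j = d j.
Proof. by rewrite /splice => ->. Qed.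

Lemma splice_ge m d c j : (m <= j)%N -> splice m d c j = c j.
Proof. by rewrite /splice ltnNge => ->. Qed.

Lemma splice_leq m d c a : (forall j, d j <= a j)%N ->
  (forall j, c j <= a j)%N -> forall j, (splice m d c j <= a j)%N.
Proof. by move=> da ca j; rewrite /splice; case: ifP. Qed.

Lemma psi_sum_splice a m d c : psi_sum a (splice m d c) m = psi_sum a d m.
Proof. by apply: eq_bigr => j _; rewrite splice_lt. Qed.

Lemma lazy_prefix_splice a d m c :
  lazy_prefix a d m -> lazy_prefix a (splice m d c) m.
Proof.
move=> h j jm; rewrite !splice_lt //; first exact: h.
exact: leq_ltn_trans (leq_pred j) jm.
Qed.

(** The interval [q_{m-1}, q_m + q_{m-1}) splits according to the top digit.
    Its initial part, of length q_{m-2}, is reached with top digit 0 below a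
    maximal digit. The rest is cut into a_m intervals of length q_{m-1}, which
    are the translates by c q_{m-1}, for 1 <= c <= a_m, of the interval for
    m - 1. *)
Lemma lazy_prefix_exists a m n : (forall j, 0 < a j)%N ->
  (cf_den a m <= n < cf_den a m.+1 + cf_den a m)%N ->
  exists d, [/\ forall j, (d j <= a j)%N, lazy_prefix a d m & psi_sum a d m = n].
Proof.
move=> a_gt0; elim/ltn_ind: m n => -[|m] IH n /andP[n1 n2].
  exists (fun=> 0%N); split=> //; rewrite psi_sum0.
  by move: n2; rewrite /cf_den /=; case: n {n1}.
have [_ q0] := cf_den_growth a a_gt0 m.
have [nlt|nge] := ltnP n (cf_den a m.+1 + cf_den a m)%N.
  case: m => [|m] in IH n n1 n2 nlt q0 *.
    by move: n1 nlt; rewrite /cf_den /=; lia.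
  have [|d [da dl ds]] := IH m (ltnW (ltnSn _)) (n - a m * cf_den a m.+1)%N.
    by move: n1 nlt; rewrite (cf_denSS a m); lia.
  pose c j := if j == m then a m else 0%N.
  have cm : c m = a m by rewrite /c eqxx.
  have cm1 : c m.+1 = 0%N by rewrite /c; case: eqP => //; lia.
  exists (splice m d c); split.
  - by apply: splice_leq => // j; rewrite /c; case: eqP => // ->.
  - apply: lazy_prefixS; last by rewrite /= (splice_ge _ _ _ _ (leqnn m)) cm.
    apply: lazy_prefixS; first exact: lazy_prefix_splice.
    by rewrite splice_ge // cm => am0; move: (a_gt0 m); rewrite am0.
  - rewrite !psi_sumS psi_sum_splice ds !splice_ge // cm cm1.
    by move: n1; rewrite (cf_denSS a m); lia.
(* Subtracting q_{m-1} first makes Euclidean division return a remainder r in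
   the interval for the shorter prefix and a quotient k >= 1. *)
pose r := ((n - cf_den a m) %% cf_den a m.+1 + cf_den a m)%N.
pose k := ((n - cf_den a m) %/ cf_den a m.+1)%N.
have nE : n = (r + k * cf_den a m.+1)%N.
  by have := divn_eq (n - cf_den a m) (cf_den a m.+1); rewrite /r /k; lia.
have k0 : (0 < k)%N by rewrite divn_gt0 //; lia.
have ka : (k <= a m)%N.
  rewrite -ltnS ltn_divLR // mulSn.
  by move: n2 nge; rewrite cf_denSS; lia.
have [|d [da dl ds]] := IH m (ltnSn _) r.
  by have := ltn_pmod (n - cf_den a m) q0; rewrite /r; lia.
pose c j := if j == m then k else 0%N.
have cm : c m = k by rewrite /c eqxx.
exists (splice m d c); split.
- by apply: splice_leq => // j; rewrite /c; case: eqP => // ->.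
- apply: lazy_prefixS; first exact: lazy_prefix_splice.
  by rewrite splice_ge // cm => k00; move: k0; rewrite k00.
- by rewrite psi_sumS psi_sum_splice ds splice_ge // cm.
Qed.

Lemma fsum_ord (F : nat -> int) N : (forall i, (N <= i)%N -> F i = 0) ->
  \sum_(j \in [set: nat]) F j = \sum_(j < N) F j.
Proof.
move=> F0; rewrite fsbig_ord; symmetry; apply: fsbig_widen => // i [_ /=].
by move=> /negP; rewrite -leqNgt => /F0.
Qed.

(** * The continued fraction of alpha *)

Lemma frac_partE (R : realType) (x y : R) (z : int) :
  0 <= y < 1 -> y = x - z%:~R -> y = frac_part x.
Proof.
move=> y01 yE; rewrite /frac_part (@floor_def _ x z) // intrD.
by rewrite yE in y01; lra.
Qed.

Lemma irrational_invB (R : realType) (x : R) (z : int) :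
  irrational x -> irrational (x^-1 - z%:~R).
Proof.
move=> irrx [q _ qE]; apply: irrx; exists ((q + z%:~R)^-1) => //.
by rewrite fmorphV rmorphD /= ratr_int qE subrK invrK.
Qed.

Section Irrational.
Variables (R : realType) (alpha : R).
Hypothesis alpha01 : 0 < alpha < 1.
Hypothesis alpha_irr : irrational alpha.
Local Notation a := (cf_digit alpha).
Local Notation q := (cf_den a).
Local Notation p := (cf_num a).

Definition cf_remainder k : R := iter k (fun x => frac_part x^-1) alpha.

Lemma cf_remainderP k :
  [/\ 0 < cf_remainder k, cf_remainder k < 1 & irrational (cf_remainder k)].
Proof.
elim: k => [|k [x0 x1 xirr]]; first by case/andP: alpha01; split.
rewrite /cf_remainder iterS -/(cf_remainder k) /frac_part.
have irr := irrational_invB _ _ (Num.floor (cf_remainder k)^-1) xirr.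
split=> //; last by have := lt_succ_floor (cf_remainder k)^-1; rewrite intrD; lra.
rewrite lt_neqAle subr_ge0 floor_le_tmp andbT; apply/eqP => e; apply: irr.
by rewrite -e; exists 0 => //; rewrite rmorph0.
Qed.

Lemma cf_remainder_ge0 k : 0 <= cf_remainder k.
Proof. by have [/ltW] := cf_remainderP k. Qed.

Lemma cf_remainderV k : (cf_remainder k)^-1 = (a k)%:R + cf_remainder k.+1.
Proof.
have [x0 x1 _] := cf_remainderP k.
rewrite {2}/cf_remainder iterS -/(cf_remainder k) /frac_part.
rewrite /cf_digit -/(cf_remainder k) truncn_floor.
rewrite invr_ge0 ltW // natr_absz ger0_norm ?floor_ge0 ?invr_ge0 ?ltW //.
by rewrite addrC subrK.
Qed.

Lemma cf_digit_gt0 k : (0 < a k)%N.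
Proof.
have [x0 x1 _] := cf_remainderP k.
by rewrite /cf_digit -/(cf_remainder k) truncn_gt0 invf_ge1 // ltW.
Qed.
Local Hint Resolve cf_digit_gt0 : core.

Lemma convergentE k : convergent alpha k = (p k.+1)%:~R / (q k.+1)%:~R.
Proof. by rewrite /convergent foldr_cf ?mulr0 ?addr0. Qed.

Lemma cf_qE k : cf_q alpha k = q k.+1.
Proof.
have [_ q0] := cf_den_growth a cf_digit_gt0 k.
by rewrite /cf_q convergentE coprimeq_den ?coprime_cf // eqz_nat gtn_eqF.
Qed.

Lemma cf_pE k : cf_p alpha k = p k.+1.
Proof.
have [_ q0] := cf_den_growth a cf_digit_gt0 k.
by rewrite /cf_p convergentE coprimeq_num ?coprime_cf // gtr0_sg // mul1r.
Qed.

Lemma alpha_foldr k : alpha =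
  foldr (fun (b : nat) (y : R) => (b%:R + y)^-1) (cf_remainder k) (mkseq a k).
Proof.
elim: k => // k IH; rewrite mkseqS foldr_rcons -cf_remainderV invrK; exact: IH.
Qed.

(** With the index shift of the denominators: [cf_err k.+1] is
    theta_k = q_k alpha - p_k, and [cf_err 0] is theta_{-1} = -1. *)
Definition cf_err k : R := (q k)%:R * alpha - (p k)%:R.

Lemma cf_err0 : cf_err 0 = -1.
Proof. by rewrite /cf_err /cf_den /cf_num /= mul0r sub0r. Qed.

Lemma cf_errSS k : cf_err k.+2 = (a k)%:R * cf_err k.+1 + cf_err k.
Proof. rewrite /cf_err cf_denSS cf_numSS !natrD !natrM; ring. Qed.

(** Writing alpha as a homographic function of the k-th remainder and using the
    determinant identity gives theta_k in closed form; both its sign and its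
    size are read off from it. *)
Lemma cf_err_formula k :
  ((q k.+1)%:R + (q k)%:R * cf_remainder k) * cf_err k.+1 =
  (-1) ^+ k * cf_remainder k.
Proof.
have x0 := cf_remainder_ge0 k.
have d0 := cf_den_comb_gt0 _ cf_digit_gt0 _ k _ x0.
have /(congr1 (fun z : int => z%:~R : R)) := cf_det a k.
rewrite rmorphB !rmorphM /= rmorphXn /= rmorphN1 => <-.
have := alpha_foldr k; rewrite foldr_cf //.
set D := _ + _ in d0 *.
move/(congr1 (fun y => y * D)); rewrite (divfK (lt0r_neq0 d0)) => aE.
transitivity ((q k.+1)%:R * (alpha * D) - (p k.+1)%:R * D).
  by rewrite /cf_err; ring.
by rewrite aE /D; ring.
Qed.

Lemma cf_err_sign k : if odd k then 0 < cf_err k else cf_err k < 0.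
Proof.
case: k => [|k]; first by rewrite cf_err0 /=; lra.
have : 0 < (-1) ^+ k * cf_err k.+1.
  have [x0 _ _] := cf_remainderP k.
  have d0 := cf_den_comb_gt0 _ cf_digit_gt0 _ k _ (ltW x0).
  rewrite -(pmulr_rgt0 _ d0) mulrCA cf_err_formula mulrA -expr2.
  by rewrite sqrr_sign mul1r.
by rewrite -signr_odd /=; case: (odd k); rewrite /= ?expr1 ?expr0; lra.
Qed.

Lemma cf_err_small k : k%:R * `|cf_err k.+1| <= 1.
Proof.
have [x0 x1 _] := cf_remainderP k.
have [kq _] := cf_den_growth a cf_digit_gt0 k.
have d0 := cf_den_comb_gt0 _ cf_digit_gt0 _ k _ (ltW x0).
have /(congr1 Num.norm) := cf_err_formula k.
rewrite !normrM normr_sign mul1r (gtr0_norm x0) (gtr0_norm d0) => e.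
apply: (le_trans _ (ltW x1)); rewrite -e ler_wpM2r //.
by rewrite ler_wpDr ?mulr_ge0 ?(ltW x0) // ler_nat.
Qed.

Lemma cf_err_cvg : cf_err n @[n --> \oo] --> 0.
Proof.
rewrite -cvg_shiftS; apply/cvgr0Pnorm_lt => e e0.
near=> n.
have n0 : (0 < n%:R :> R) by rewrite ltr0n; near: n; exact: nbhs_infty_gt.
rewrite -(ltr_pM2l n0); apply: (le_lt_trans (cf_err_small n)).
rewrite -ltr_pdivrMr //; near: n.
exact: nbhs_infty_gtr.
Unshelve. all: by end_near. Qed.

(** * The order isomorphism *)

(** The boolean tells the two halves of F_alpha apart, so that both are treated
    at once: maximal digits from index N on if it is true, zeros otherwise. *)
Definition ends_at (b : bool) N (d : nat -> nat) : Prop :=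
  forall i, (N <= i)%N -> d i = if b then a i else 0%N.

Lemma ends_atW b N M d : (N <= M)%N -> ends_at b N d -> ends_at b M d.
Proof. by move=> NM h i Mi; apply: h; exact: leq_trans Mi. Qed.

Lemma FsetP d : Fset alpha d <->
  admissible alpha d /\ exists b N, ends_at b N d.
Proof.
split=> [[[? [N h]]|[? [N h]]]|[? [[] [N h]]]].
- by split=> //; exists false, N.
- by split=> //; exists true, N.
- by right; split=> //; exists N.
- by left; split=> //; exists N.
Qed.

Lemma Psi_extE b N d : admissible alpha d -> ends_at b N d ->
  Psi_ext alpha d =
  (psi_sum a d N)%:Z - (if b then (q N.+1 + q N)%N else 0%N)%:Z.
Proof.
move=> ad td; rewrite /Psi_ext; case: b td => td.
- rewrite ifF; last first.
    apply/negbTE/negP; rewrite inE => -[_ [M hM]].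
    have := hM (maxn M N) (leq_maxl _ _); rewrite td ?leq_maxr // => e.
    by have := cf_digit_gt0 (maxn M N); rewrite e.
  rewrite (@fsum_ord _ N) => [|i Ni]; last by rewrite td // subrr mul0r.
  rewrite -psi_sum_max -addn1 PoszD !psi_sumZ.
  under eq_bigr do rewrite cf_qE // mulrBl.
  rewrite sumrB; ring.
- rewrite ifT ?inE; last by split=> //; exists N.
  rewrite /Psi (@fsum_ord _ N) => [|i Ni]; last by rewrite td // mul0r.
  by rewrite subr0 psi_sumZ; apply: eq_bigr => j _; rewrite cf_qE.
Qed.

Lemma Psi_ext_lt0 N d : admissible alpha d -> ends_at true N d ->
  Psi_ext alpha d < 0.
Proof.
move=> ad td; have [da _ _] := ad; rewrite (Psi_extE _ _ _ ad td).
have := leq_psi_sum a d N da; have := psi_sum_max a N; lia.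
Qed.

Lemma admissible_lazy_prefix d k :
  admissible alpha d -> (0 < d k)%N -> lazy_prefix a d k.
Proof.
move=> [_ h _] dk j jk dj; have [/(_ k (ltnW jk)) e|//] := h _ dj.
by move: dk; rewrite e.
Qed.

Lemma ltR_Psi_ext d d' : Fset alpha d -> Fset alpha d' -> ltR alpha d d' ->
  Psi_ext alpha d < Psi_ext alpha d'.
Proof.
move=> /FsetP[ad [b [N td]]] /FsetP[ad' [b' [N' td']]] [k].
have [da _ _] := ad.
case=> [[dk ddE]|h].
- pose M := maxn k.+1 (maxn N N').
  have {}td : ends_at b M d by apply: ends_atW td; rewrite /M; lia.
  have {}td' : ends_at b' M d' by apply: ends_atW td'; rewrite /M; lia.
  have bb' : b = b'.
    have : d M = d' M by apply: ddE; rewrite /M leq_maxl.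
    rewrite td // td' //; have := cf_digit_gt0 M.
    by case: b {td}; case: b' {td'} => //= ? ?; exfalso; lia.
  rewrite -{}bb' in td'.
  rewrite (Psi_extE _ _ _ ad td) (Psi_extE _ _ _ ad' td') ltrD2r ltz_nat.
  apply: (@psi_sum_lt_extend _ _ _ k.+1); [by rewrite leq_maxl | exact: ddE |].
  apply: psi_sum_lt => //; apply: (admissible_lazy_prefix _ _ ad'); lia.
- have t1 : ends_at true k d by move=> i /h[].
  have t2 : ends_at false k d' by move=> i /h[].
  by rewrite (lt_le_trans (Psi_ext_lt0 _ _ ad t1)) // (Psi_extE _ _ _ ad' t2) subr0.
Qed.

(** Both halves of F_alpha consist of sequences with a common tail, so two of
    their members differ at finitely many places, and the last of these decides;
    across the halves, the second clause of the order decides. *)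
Lemma ltR_total d d' : Fset alpha d -> Fset alpha d' ->
  [\/ d = d', ltR alpha d d' | ltR alpha d' d].
Proof.
have main N e e' : (forall i, (N <= i)%N -> e i = e' i) ->
    [\/ e = e', ltR alpha e e' | ltR alpha e' e].
  elim: N => [|N IH] h; first by apply: Or31; apply/funext => i; exact: h.
  case: (ltngtP (e N) (e' N)) => eN.
  - by apply: Or32; exists N; left.
  - by apply: Or33; exists N; left; split=> // i /h.
  - apply: IH => i; rewrite leq_eqVlt => /orP[/eqP<-//|]; exact: h.
move=> /FsetP[_ [b [N td]]] /FsetP[_ [b' [N' td']]].
have {}td := ends_atW _ _ _ _ (leq_maxl N N') td.
have {}td' := ends_atW _ _ _ _ (leq_maxr N N') td'.
move: (maxn _ _) td td' => M; case: b; case: b' => td td'.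
- by apply: (main M) => i Mi; rewrite td // td'.
- by apply: Or32; exists M; right => i Mi; rewrite td // td'.
- by apply: Or33; exists M; right => i Mi; rewrite td // td'.
- by apply: (main M) => i Mi; rewrite td // td'.
Qed.

Lemma Psi_ext_le d d' : Fset alpha d -> Fset alpha d' ->
  (leR alpha d d' <-> Psi_ext alpha d <= Psi_ext alpha d').
Proof.
move=> Fd Fd'; split=> [[->//|/ltR_Psi_ext h]|]; first exact/ltW/h.
case: (ltR_total _ _ Fd Fd') => [->|lt|/(ltR_Psi_ext _ _ Fd' Fd)].
- by left.
- by right.
- by rewrite ltNge => /negbTE ->.
Qed.

Lemma Psi_ext_inj : set_inj (Fset alpha) (Psi_ext alpha).
Proof.
move=> d d'; rewrite !inE => Fd Fd' e.
case: (ltR_total _ _ Fd Fd') => //.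
  by move/(ltR_Psi_ext _ _ Fd Fd'); rewrite e ltxx.
by move/(ltR_Psi_ext _ _ Fd' Fd); rewrite e ltxx.
Qed.

Lemma admissible_splice b m d : (forall j, d j <= a j)%N -> lazy_prefix a d m ->
  admissible alpha (splice m d (fun i => if b then a i else 0%N)).
Proof.
move=> da dl; set d' := splice _ _ _.
have ge j : (m <= j)%N -> d' j = if b then a j else 0%N by exact: splice_ge.
split.
- by apply: splice_leq => // j; case: b {d' ge}.
- move=> j dj; have [jm|mj] := ltnP j m.
    by right; apply: (lazy_prefix_splice _ _ _ _ dl).
  left=> i ji; have mi := leq_trans mj ji.
  rewrite ge //; case: b @d' dj ge => // d' dj ge.
  by have := cf_digit_gt0 j; rewrite -[a j]ge // dj.
- move=> [k h]; have [h1 h2] := h m.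
  (* The forbidden pattern has both a maximal and a zero digit beyond m. *)
  have m1 : (m <= k + m.*2)%N by rewrite -addnn addnA leq_addl.
  move: h1 h2; rewrite !ge //; last exact: leqW.
  case: (b) => [_|e _]; first by have := cf_digit_gt0 (k + m.*2).+1; lia.
  by have := cf_digit_gt0 (k + m.*2); rewrite -e.
Qed.

Lemma Psi_ext_surj : set_surj (Fset alpha) [set: int] (Psi_ext alpha).
Proof.
have main b m n : (q m <= n < q m.+1 + q m)%N ->
    (Fset alpha `&` [set d | Psi_ext alpha d =
       n%:Z - (if b then (q m.+1 + q m)%N else 0%N)%:Z]) !=set0.
  move=> /(lazy_prefix_exists _ _ _ cf_digit_gt0)[d [da dl ds]].
  have ad := admissible_splice b _ _ da dl.
  have td : ends_at b m (splice m d (fun i => if b then a i else 0%N)).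
    by move=> i mi; rewrite splice_ge.
  eexists; split; first by apply/FsetP; split; [exact: ad|exists b, m; exact: td].
  by rewrite /= (Psi_extE _ _ _ ad td) psi_sum_splice ds.
have grow := cf_den_growth a cf_digit_gt0.
suff: forall n : int, (Fset alpha `&` [set d | Psi_ext alpha d = n]) !=set0.
  by move=> h n _; have [d [Fd /= dE]] := h n; exists d.
case=> n.
- (* The least m with n < q_m + q_{m-1} also satisfies q_{m-1} <= n. *)
  have ex : exists m, (n < q m.+1 + q m)%N.
    by exists n.+1; have [] := grow n.+1; lia.
  have [m mE mmin] := ex_minnP ex.
  have [|d [Fd /= dE]] := main false m n; last first.
    by exists d; split=> //=; rewrite dE subr0.
  rewrite mE andbT; case: m mE mmin => // m mE mmin.
  rewrite leqNgt; apply/negP => lt; have := mmin m; lia.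
- (* [Negz n] is -(n + 1); any m with q_m > n would do, and q_{n+1} >= n + 1. *)
  have [lt _] := grow n.+1.
  have [|d [Fd /= dE]] := main true n.+1 (q n.+2 + q n.+1 - n.+1)%N.
    by lia.
  by exists d; split=> //=; rewrite dE NegzE; lia.
Qed.

(** * The values of Lambda *)

Definition err_sum (d : nat -> nat) m : R :=
  \sum_(j < m) (d j)%:R * cf_err j.+1.

Lemma err_sumS d m : err_sum d m.+1 = err_sum d m + (d m)%:R * cf_err m.+1.
Proof. by rewrite /err_sum big_ord_recr. Qed.

Lemma err_sum0 d : err_sum d 0 = 0.
Proof. by rewrite /err_sum big_ord0. Qed.

(** Terms with negative theta are dropped; maximal digits in front of the
    positive ones telescope, since a_j theta_{j-1} = theta_j - theta_{j-2}. The
    index [m + odd m] is even, so the last theta is negative. *)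
Lemma err_sum_ub d m : (forall j, d j <= a j)%N ->
  err_sum d m <= 1 + cf_err (m + odd m).
Proof.
move=> da; elim: m => [|m IH]; first by rewrite err_sum0 cf_err0; lra.
have := cf_err_sign m.+1; have dm : (d m)%:R <= (a m)%:R :> R by rewrite ler_nat.
rewrite err_sumS /=; move: IH; case: (odd m) => /= IH s.
  rewrite addn1 addn0 in IH *.
  have : (d m)%:R * cf_err m.+1 <= 0 by rewrite mulr_ge0_le0 ?ler0n ?ltW.
  lra.
rewrite addn1 addn0 in IH *; rewrite cf_errSS.
have := ler_wpM2r (ltW s) dm; lra.
Qed.

(** The mirror image of the upper bound, which starts from theta_0 = alpha
    thanks to the nonzero first digit. *)
Lemma err_sum_lb d m : (forall j, d j <= a j)%N -> (0 < d 0)%N -> (0 < m)%N ->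
  cf_err (m + ~~ odd m) <= err_sum d m.
Proof.
move=> da d0; case: m => // m _; elim: m => [|m IH].
  have t1 := cf_err_sign 1.
  rewrite err_sumS err_sum0 add0r addn0 -{1}[cf_err _]mul1r.
  by apply: ler_wpM2r (ltW t1) _ _ _; rewrite ler1n.
have := cf_err_sign m.+2.
have dm : (d m.+1)%:R <= (a m.+1)%:R :> R by rewrite ler_nat.
rewrite err_sumS /=; move: IH; rewrite /= negbK; case: (odd m) => /= IH s.
  rewrite addn1 addn0 in IH *.
  have : 0 <= (d m.+1)%:R * cf_err m.+2 by rewrite mulr_ge0 ?ler0n ?ltW.
  lra.
rewrite addn1 addn0 in IH *; rewrite cf_errSS.
have : (a m.+1)%:R * cf_err m.+2 <= (d m.+1)%:R * cf_err m.+2.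
  by rewrite ler_wnM2r // ltW.
lra.
Qed.

Lemma err_sum_lt1 d m : (forall j, d j <= a j)%N -> err_sum d m < 1.
Proof.
move=> da; apply: (le_lt_trans (err_sum_ub _ m da)).
by have := cf_err_sign (m + odd m); rewrite oddD oddb addbb; lra.
Qed.

Lemma err_sum_int d m :
  exists z : int, err_sum d m = (psi_sum a d m)%:R * alpha - z%:~R.
Proof.
elim: m => [|m [z IH]]; first by exists 0; rewrite err_sum0 psi_sum0; lra.
exists (z + (d m * p m.+1)%N).
rewrite err_sumS IH psi_sumS /cf_err natrD natrM intrD.
by rewrite -[(Posz _)%:~R]pmulrn natrM; ring.
Qed.

(** The corrected partial sums are stationary: once the digits are maximal, the
    added terms telescope against the correction. *)
Lemma err_sum_ends_at b N d M : ends_at b N d -> (N <= M)%N ->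
  err_sum d M - (if b then cf_err M.+1 + cf_err M else 0) =
  err_sum d N - (if b then cf_err N.+1 + cf_err N else 0).
Proof.
move=> td /subnKC <-; elim: (M - N)%N => [|t IH]; first by rewrite addn0.
rewrite addnS err_sumS cf_errSS -{}IH td ?leq_addr //.
by case: b td => _; ring.
Qed.

Lemma err_sum_ends_at_cvg b N d : ends_at b N d -> err_sum d m @[m --> \oo] -->
  err_sum d N - (if b then cf_err N.+1 + cf_err N else 0).
Proof.
move=> td; set l := err_sum d N - _.
have t0 : (fun M => l + (if b then cf_err M.+1 + cf_err M else 0)) @ \oo --> l.
  rewrite -[X in _ --> X]addr0; apply: cvgD; first exact: cvg_cst.
  case: b {td l}; last exact: cvg_cst.
  rewrite -[X in _ --> X]addr0; apply: cvgD; last exact: cf_err_cvg.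
  by rewrite (cvg_shiftS cf_err); exact: cf_err_cvg.
apply: cvg_trans t0; apply: near_eq_cvg; near=> M.
rewrite /l -(@err_sum_ends_at b N d M) ?subrK //.
by near: M; exact: nbhs_infty_ge.
Unshelve. all: by end_near. Qed.

Lemma LambdaE d : Lambda alpha d = limn (err_sum d).
Proof.
rewrite /Lambda; congr (limn _); apply/funext => m.
by rewrite /series /= big_mkord; apply: eq_bigr => j _; rewrite cf_qE cf_pE.
Qed.

Lemma Lambda_ends_at b N d : ends_at b N d -> Lambda alpha d =
  err_sum d N - (if b then cf_err N.+1 + cf_err N else 0).
Proof. by move=> /err_sum_ends_at_cvg h; rewrite LambdaE; apply: cvg_lim. Qed.

Lemma err_sum_cvg d :
  Fset alpha d -> err_sum d n @[n --> \oo] --> Lambda alpha d.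
Proof.
move=> /FsetP[_ [b [N td]]].
by rewrite (Lambda_ends_at _ _ _ td); exact: err_sum_ends_at_cvg.
Qed.

(** The correction terms of [Psi_extE] and [Lambda_ends_at] correspond under
    q_k alpha = theta_k + p_k, so only integers are left over. *)
Lemma Lambda_int d : Fset alpha d -> exists z : int,
  Lambda alpha d = (Psi_ext alpha d)%:~R * alpha - z%:~R.
Proof.
move=> /FsetP[ad [b [N td]]]; have [z zE] := err_sum_int d N.
rewrite (Lambda_ends_at b N) // (Psi_extE b N _ ad td) zE.
exists (z - (if b then p N.+1 + p N else 0)%N%:Z).
rewrite !intrB -!pmulrn; case: b {td}; rewrite ?natrD /cf_err; ring.
Qed.

Lemma admissible_head0 d :
  admissible alpha d -> d 0 = 0%N -> ends_at false 0 d.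
Proof. by move=> [_ h _] /h[//|[]]. Qed.

Lemma Lambda_ge0 d : Fset alpha d -> 0 <= Lambda alpha d.
Proof.
move=> Fd; have [ad _] := (FsetP d).1 Fd; have [da _ _] := ad.
have [d0|d0] := posnP (d 0).
  by rewrite (Lambda_ends_at _ _ _ (admissible_head0 _ ad d0)) err_sum0 subr0.
apply: (cvgr_to_ge (err_sum_cvg _ Fd)); near=> m.
have m0 : (0 < m)%N by near: m; exact: nbhs_infty_gt.
apply: le_trans (err_sum_lb _ _ da d0 m0).
by have := cf_err_sign (m + ~~ odd m); rewrite oddD oddb addbN addbb => /ltW.
Unshelve. all: by end_near. Qed.

(** For a finite sequence Lambda is a partial sum. For the others the limit
    gives only Lambda <= 1; equality is impossible, for Lambda is Psi * alpha up
    to an integer, with Psi < 0 and alpha irrational. *)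
Lemma Lambda_lt1 d : Fset alpha d -> Lambda alpha d < 1.
Proof.
move=> Fd; have [ad [b [N td]]] := (FsetP d).1 Fd; have [da _ _] := ad.
case: b td => td; last by rewrite (Lambda_ends_at _ _ _ td) subr0 err_sum_lt1.
rewrite lt_neqAle; apply/andP; split; last first.
  by apply: (cvgr_to_le (err_sum_cvg _ Fd)); near=> m; exact/ltW/err_sum_lt1.
have [z ->] := Lambda_int _ Fd.
have Psi_neq0 := ltr0_neq0 (Psi_ext_lt0 _ _ ad td).
apply/eqP => /eqP; rewrite subr_eq => /eqP e; apply: alpha_irr.
exists ((1 + z%:~R) / (Psi_ext alpha d)%:~R) => //.
rewrite fmorph_div /= rmorphD /= rmorph1 !ratr_int -e mulrC mulKf //.
by rewrite intr_eq0.
Unshelve. all: by end_near. Qed.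

End Irrational.

Theorem proposition5 (R : realType) (alpha : R)
    (alpha01 : 0 < alpha < 1) (alpha_irr : irrational alpha) :
  [/\ set_bij (Fset alpha) [set: int] (Psi_ext alpha),
      (forall d d' : nat -> nat, Fset alpha d -> Fset alpha d' ->
         (leR alpha d d' <-> Psi_ext alpha d <= Psi_ext alpha d')) &
      forall n : int,
        Lambda alpha (Psi_ext_inv alpha n) = frac_part (n%:~R * alpha)].
Proof.
have surj := Psi_ext_surj R alpha alpha01 alpha_irr.
split=> [||n]; first by split=> //; exact: Psi_ext_inj.
  exact: Psi_ext_le.
have Fd : Fset alpha (Psi_ext_inv alpha n).
  by apply: (surjpinv_image_sub surj); exists n.
have nE : Psi_ext alpha (Psi_ext_inv alpha n) = n.
  by rewrite /Psi_ext_inv (surjpK _ surj) // inE.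
have [z] := Lambda_int _ _ alpha01 alpha_irr _ Fd; rewrite nE => zE.
apply: (frac_partE _ _ _ z) => //.
by rewrite Lambda_ge0 // Lambda_lt1.
Qed.
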